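(* Let $\Sigma$ be a finite alphabet and let $L\subseteq\Sigma^*$ be a language recognized by some MO-1gQFA with bounded error $\epsilon$ for some $\epsilon>0$. Then $L$ is a regular language.
   Context: For a finite-dimensional complex Hilbert space $\mathcal{H}$, let $L(\mathcal{H})$ be the set of linear operators on $\mathcal{H}$. A density operator on $\mathcal{H}$ is a positive semidefinite operator of trace $1$. A trace-preserving quantum operation acting on $\mathcal{H}$ is a map $\mathcal{E}:L(\mathcal{H})\to L(\mathcal{H})$ of the form $\mathcal{E}(\rho)=\sum_k E_k\rho E_k^\dagger$ (finite sum, $E_k\in L(\mathcal{H})$) with $\sum_k E_k^\dagger E_k=I$. A measure-once one-way general quantum finite automaton (MO-1gQFA) is a tuple $\mathcal{M}=\{\mathcal{H},\Sigma,\rho_0,\{\mathcal{E}_\sigma\}_{\sigma\in\Sigma},P_{acc}\}$ where $\mathcal{H}$ is a finite-dimensional Hilbert space, $\Sigma$ is a finite input alphabet, $\rho_0$ is a density operator on $\mathcal{H}$ (the initial state), each $\mathcal{E}_\sigma$ is a trace-preserving quantum operation acting on $\mathcal{H}$, and $P_{acc}$ is an orthogonal projector on a subspace of $\mathcal{H}$. It induces the function $f_{\mathcal{M}}:\Sigma^*\to[0,1]$, $$f_{\mathcal{M}}(\sigma_1\sigma_2\cdots\sigma_n)=\mathrm{Tr}\big(P_{acc}\,\mathcal{E}_{\sigma_n}\circ\cdots\circ\mathcal{E}_{\sigma_2}\circ\mathcal{E}_{\sigma_1}(\rho_0)\big)$$ (for the empty word, $\mathrm{Tr}(P_{acc}\rho_0)$).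 A language $L\subseteq\Sigma^*$ is recognized by $\mathcal{M}$ with bounded error $\epsilon$ ($\epsilon>0$) if for some $\lambda\in(0,1]$, $f_{\mathcal{M}}(x)\ge\lambda+\epsilon$ for every $x\in L$ and $f_{\mathcal{M}}(y)\le\lambda-\epsilon$ for every $y\in\Sigma^*\setminus L$. A language is regular if it is accepted by a (deterministic) finite automaton. *)

(* Defs.v *)
From mathcomp Require Import all_boot all_order all_algebra.
From mathcomp Require Import complex.
From mathcomp Require Import classical_sets reals.

Set Implicit Arguments.
Unset Strict Implicit.
Unset Printing Implicit Defensive.

Import Order.TTheory GRing.Theory Num.Theory.
Local Open Scope ring_scope.
Local Open Scope complex_scope.
Local Open Scope sesquilinear_scope.

(* A finite-dimensional complex Hilbert space is represented by the column
   vectors of R[i]^n with the standard inner product, and its operators by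
   'M[R[i]]_n; A ^t* is the conjugate transpose, i.e. the adjoint of A. *)

(* The order of R[i] is partial: 0 <= z means that z is real and
   nonnegative. *)
Definition psdmx (R : realType) (n : nat) (A : 'M[R[i]]_n) : Prop :=
  A \is hermsymmx /\ forall v : 'cV[R[i]]_n, 0 <= (v ^t* *m A *m v) 0 0.

(* The trace condition forces 0 < n. *)
Definition density (R : realType) (n : nat) (rho : 'M[R[i]]_n) : Prop :=
  psdmx rho /\ \tr rho = 1.

Definition tp_quantum_operation (R : realType) (n : nat)
    (F : 'M[R[i]]_n -> 'M[R[i]]_n) : Prop :=
  exists Es : seq 'M[R[i]]_n,
    \sum_(E <- Es) E ^t* *m E = 1%:M /\
    forall rho, F rho = \sum_(E <- Es) E *m rho *m E ^t*.

Definition orthogonal_projector (R : realType) (n : nat) (P : 'M[R[i]]_n) :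
    Prop :=
  P \is hermsymmx /\ P *m P = P.

Record mo1gqfa (R : realType) (Sigma : finType) := MO1gQFA {
  qdim : nat;
  qinit : 'M[R[i]]_qdim;
  qop : Sigma -> 'M[R[i]]_qdim -> 'M[R[i]]_qdim;
  qacc : 'M[R[i]]_qdim;
  qinitP : density qinit;
  qopP : forall s : Sigma, tp_quantum_operation (qop s);
  qaccP : orthogonal_projector qacc
}.

Definition qrun (R : realType) (Sigma : finType) (M : mo1gqfa R Sigma)
    (w : seq Sigma) : 'M[R[i]]_(qdim M) :=
  foldl (fun rho s => qop s rho) (qinit M) w.

(* This trace is always real, lying in [0, 1]; it is kept in R[i] and
   compared with real thresholds through the embedding _%:C. *)
Definition accept_prob (R : realType) (Sigma : finType) (M : mo1gqfa R Sigma)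
    (w : seq Sigma) : R[i] :=
  \tr (qacc M *m qrun M w).

Definition recognizes (R : realType) (Sigma : finType) (M : mo1gqfa R Sigma)
    (eps : R) (L : set (seq Sigma)) : Prop :=
  exists lambda : R,
    [/\ 0 < lambda <= 1,
        forall x, L x -> (lambda + eps)%:C <= accept_prob M x
      & forall y, ~ L y -> accept_prob M y <= (lambda - eps)%:C].

Record dfa (Sigma : finType) := DFA {
  state : finType;
  start : state;
  step : state -> Sigma -> state;
  final : {set state}
}.

Definition dfa_accepts (Sigma : finType) (A : dfa Sigma) (w : seq Sigma) :
    bool :=
  foldl (@step Sigma A) (start A) w \in final A.

Definition regular (Sigma : finType) (L : set (seq Sigma)) : Prop :=
  exists A : dfa Sigma, forall w, L w <-> dfa_accepts A w.

(* Main.v *)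
(** In the Heisenberg picture, reading a suffix w turns the acceptance
    projector into an effect A_w, 0 <= A_w <= 1, so that
    f(u w) = Tr (A_w rho_u), where rho_u is the state reached after u.  Entries
    of effects and of density matrices have real and imaginary parts in
    [-1, 1].  Hence, if rho_u and rho_v are entrywise close, then
    |f(u w) - f(v w)| < 2 eps for all w at once, and u and v are
    Myhill-Nerode equivalent; a finite grid on the entries of rho_u then has
    the states of a finite automaton as its cells. *)

Require Import Defs.
From mathcomp Require Import all_boot all_order all_algebra.
From mathcomp Require Import complex.
From mathcomp Require Import classical_sets reals.
From mathcomp Require Import boolp ring lra.

Set Implicit Arguments.
Unset Strict Implicit.
Unset Printing Implicit Defensive.

Import Order.TTheory GRing.Theory Num.Theory.
Local Open Scope ring_scope.
Local Open Scope complex_scope.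
Local Open Scope sesquilinear_scope.

(* The automaton runs on colours; each transition is computed from a chosen
   word of the current colour. *)
Lemma regular_of_finite_right_coloring (Sigma C : finType)
    (L : set (seq Sigma)) (c : seq Sigma -> C) :
  (forall u v, c u = c v -> forall w, L (u ++ w) -> L (v ++ w)) -> regular L.
Proof.
move=> Lc.
have [rep repP] : exists rep : C -> seq Sigma, forall u, c (rep (c u)) = c u.
  (* A colour that no word attains gets the empty word, its condition being vacuous, so [rep] is
     total. *)
  have h (k : C) : exists u, forall v, c v = k -> c u = k.
    by case: (pselect (exists u, c u = k)) => [[u uk]|nk];
      [exists u | exists [::] => v vk; case: nk; exists v].
  exists (fun k => sval (cid (h k))) => u.
  by case: (cid (h (c u))) => x /= /(_ u); apply.
pose A := DFA (c [::]) (fun k s => c (rcons (rep k) s)) [set k | `[< L (rep k) >]].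
exists A => w; rewrite /dfa_accepts inE /=.
have {Lc}Lc u v : c u = c v -> forall w, L (u ++ w) <-> L (v ++ w).
  by move=> uv x; split; apply: Lc.
(* Any [u] of colour [k] is allowed: [Lc] trades it for [rep k], and the induction continues with
   the prefix [rcons (rep k) s]. *)
suff H k x u : c u = k ->
    L (u ++ x) <-> L (rep (foldl (fun k s => c (rcons (rep k) s)) k x)).
  by split=> [Lw | /asboolP Lw]; [apply/asboolP|]; apply/(H (c [::]) w [::]).
elim: x k u => [|s x IH] k u uk /=.
  by have := Lc u (rep k) _ [::]; rewrite !cats0; apply; rewrite -uk repP.
rewrite -(IH _ (rcons (rep k) s)) //.
by rewrite cat_rcons; apply: Lc; rewrite -uk repP.
Qed.

(** * Positive semidefinite matrices, effects and their entries *)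

Section Adjoint.
Context {R : realType}.
Local Notation C := R[i].

Lemma adjoint_mul m n p (A : 'M[C]_(m, n)) (B : 'M[C]_(n, p)) :
  (A *m B) ^t* = B ^t* *m A ^t*.
Proof. by rewrite trmx_mul map_mxM. Qed.

Lemma hermsymmxP n (A : 'M[C]_n) : reflect (A ^t* = A) (A \is hermsymmx).
Proof.
by apply: (iffP (is_hermitianmxP _ _ _)); rewrite expr0 scale1r => /esym.
Qed.

Lemma psdmx_congr m n (A : 'M[C]_m) (E : 'M[C]_(m, n)) :
  psdmx A -> psdmx (E ^t* *m A *m E).
Proof.
move=> [/hermsymmxP hA pA]; split.
  by apply/hermsymmxP; rewrite !adjoint_mul trmxCK hA mulmxA.
by move=> v; have := pA (E *m v); rewrite adjoint_mul !mulmxA.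
Qed.

Lemma psdmx_sum n (I : Type) (r : seq I) (F : I -> 'M[C]_n) :
  (forall i, psdmx (F i)) -> psdmx (\sum_(i <- r) F i).
Proof.
move=> pF; elim/big_ind: _ => [|A B [/hermsymmxP hA pA] [/hermsymmxP hB pB]|i _] //.
- split; first by apply/hermsymmxP; rewrite trmx0 map_mx0.
  by move=> v; rewrite mulmx0 mul0mx mxE.
- split; first by apply/hermsymmxP; rewrite linearD map_mxD hA hB.
  by move=> v; rewrite mulmxDr mulmxDl mxE addr_ge0.
Qed.

(** Since [P = P ^t* *m P], the form at [v] is the squared norm of [P *m v]. *)
Lemma orthogonal_projector_psd n (P : 'M[C]_n) :
  orthogonal_projector P -> psdmx P.
Proof.
move=> [hP PP]; split=> // v; move/hermsymmxP: hP => hP.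
rewrite -PP -{1}hP mulmxA -adjoint_mul -mulmxA mxE sumr_ge0 // => i _.
by rewrite !mxE mulrC mul_conjC_ge0.
Qed.

Lemma orthogonal_projectorC n (P : 'M[C]_n) :
  orthogonal_projector P -> orthogonal_projector (1%:M - P).
Proof.
move=> [/hermsymmxP hP PP]; split.
  by apply/hermsymmxP; rewrite linearB /= map_mxB hP trmx1 map_mx1.
by rewrite mulmxBr mulmx1 mulmxBl mul1mx PP subrr subr0.
Qed.

Lemma delta_form n (A : 'M[C]_n) i j :
  (delta_mx 0 i *m A *m delta_mx j 0 : 'M_1) 0 0 = A i j.
Proof. by rewrite -rowE -colE !mxE. Qed.

Lemma form_two_deltas n (A : 'M[C]_n) i j (c : C) :
  let v : 'cV[C]_n := delta_mx i 0 + c *: delta_mx j 0 in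
  (v ^t* *m A *m v) 0 0 =
  A i i + c * A i j + c^* * A j i + c^* * c * A j j.
Proof.
move=> v.
have -> : v ^t* = delta_mx 0 i + c^* *: delta_mx 0 j.
  rewrite /v linearD linearZ /= !trmx_delta map_mxD map_mxZ.
  by rewrite !map_delta_mx.
have eD (X Y : 'M[C]_1) : (X + Y) 0 0 = X 0 0 + Y 0 0 by rewrite mxE.
have eZ (a : C) (X : 'M[C]_1) : (a *: X) 0 0 = a * X 0 0 by rewrite mxE.
rewrite /v !mulmxDl !mulmxDr -!scalemxAl -!scalemxAr.
by rewrite !(eD, eZ) !delta_form; ring.
Qed.

(** Bounding real and imaginary parts separately, instead of the modulus, keeps the estimates linear
    over [R] and fits the grid. *)
Definition entries_le1 m n (A : 'M[C]_(m, n)) : Prop :=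
  forall i j, `|complex.Re (A i j)| <= 1 /\ `|complex.Im (A i j)| <= 1.

Lemma psdmx_diag_ge0 n (A : 'M[C]_n) i : psdmx A -> 0 <= A i i.
Proof.
move=> [_ /(_ (delta_mx i 0))].
by rewrite trmx_delta map_delta_mx delta_form.
Qed.

(** Taking c = 1, -1 bounds the real part of A_ij, and c = i, -i its imaginary part, by (A_ii +
    A_jj) / 2. *)
Lemma psdmx_entries_le1 n (A : 'M[C]_n) :
  psdmx A -> (forall i, A i i <= 1) -> entries_le1 A.
Proof.
move=> [/hermsymmxP hA pA] d1 i j.
have Aji : A j i = (A i j)^* by rewrite -{1}hA !mxE.
have := d1 i; have := d1 j.
(* The form at e_i + c e_j is A_ii + A_jj + 2 Re (c A_ij) when |c| = 1. *)
have H c := pA (delta_mx i 0 + c *: delta_mx j 0).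
have := H 1; have := H (-1); have := H 'i; have := H (- 'i).
rewrite !form_two_deltas Aji; case: (A i j) (A i i) (A j j) => a b [x x'] [y y'].
rewrite !lecE /= => /andP[_ h1] /andP[_ h2] /andP[_ h3] /andP[_ h4].
move=> /andP[_ h5] /andP[_ h6].
rewrite !ler_norml; split; apply/andP; split; lra.
Qed.

Lemma effect_entries_le1 n (A : 'M[C]_n) :
  psdmx A -> psdmx (1%:M - A) -> entries_le1 A.
Proof.
move=> pA pB; apply: psdmx_entries_le1 => // i.
by have := psdmx_diag_ge0 i pB; rewrite !mxE eqxx subr_ge0.
Qed.

Lemma density_entries_le1 n (rho : 'M[C]_n) : density rho -> entries_le1 rho.
Proof.
move=> [p tr1]; apply: psdmx_entries_le1 => // i.
rewrite -tr1 /mxtrace (bigD1 i) //= lerDl sumr_ge0 // => j _.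
exact: psdmx_diag_ge0.
Qed.

Lemma density_quantum_operation n (F : 'M[C]_n -> 'M[C]_n) rho :
  tp_quantum_operation F -> density rho -> density (F rho).
Proof.
move=> [Es [E1 FE]] [p tr1]; rewrite FE; split.
  apply: psdmx_sum => E.
  by rewrite -{1}(trmxCK E); apply: psdmx_congr.
rewrite raddf_sum /= -[RHS]tr1 -[rho in RHS]mul1mx -E1 mulmx_suml raddf_sum /=.
by apply: eq_bigr => E _; rewrite mxtrace_mulC mulmxA.
Qed.

(** The witness is the dual map applied to [A]. Trace preservation of [F] makes the dual unital, so
    it sends [1 - A] to [1 - B], which is therefore positive too. *)
Lemma dual_effect n (F : 'M[C]_n -> 'M[C]_n) (A : 'M[C]_n) :
  tp_quantum_operation F -> psdmx A -> psdmx (1%:M - A) ->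
  exists B, [/\ psdmx B, psdmx (1%:M - B)
             & forall X, \tr (A *m F X) = \tr (B *m X)].
Proof.
move=> [Es [E1 FE]] pA pA'; exists (\sum_(E <- Es) E ^t* *m A *m E); split.
- by apply: psdmx_sum => E; apply: psdmx_congr.
- rewrite -E1 -sumrB; apply: psdmx_sum => E.
  by rewrite -{1}[E ^t*]mulmx1 -mulmxBl -mulmxBr; apply: psdmx_congr.
- move=> X; rewrite FE mulmx_sumr mulmx_suml !raddf_sum /=.
  apply: eq_bigr => E _.
  by rewrite !mulmxA mxtrace_mulC !mulmxA.
Qed.

(** * Trace estimate and grid *)

Lemma Re_sum (I : finType) (F : I -> C) :
  complex.Re (\sum_i F i) = \sum_i complex.Re (F i).
Proof. by apply: (big_morph (@complex.Re R)) => // -[a b] [c d]. Qed.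

(** Each of the m n products contributes a real part a x - b y, at most 2 d. *)
Lemma Re_trmul_le m n (A : 'M[C]_(m, n)) (D : 'M[C]_(n, m)) (d : R) :
    entries_le1 A ->
    (forall i j, `|complex.Re (D i j)| <= d /\ `|complex.Im (D i j)| <= d) ->
  complex.Re (\tr (A *m D)) <= (m * n)%:R * (d *+ 2).
Proof.
move=> A1 Dd.
have -> : (m * n)%:R * (d *+ 2) = \sum_(i < m) \sum_(j < n) d *+ 2.
  by rewrite !sumr_const !card_ord -mulrnA mulnC mulr_natl.
rewrite /mxtrace Re_sum ler_sum // => i _.
rewrite mxE Re_sum ler_sum // => j _.
case: (A i j) (D j i) (A1 i j) (Dd j i) => a b [x y] /= [a1 b1] [xd yd].
rewrite mulr2n (le_trans (ler_norm _)) // (le_trans (ler_normB _ _)) //.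
by rewrite !normrM lerD // -[leRHS]mul1r ler_pM.
Qed.

(** Cells of width 1/N on [-1, 1]; the endpoint 1 alone has index 2 N, hence the successor. Beyond
    the range, [inord] falls back to 0. *)
Definition grid (N : nat) (x : R) : 'I_(2 * N).+1 :=
  inord (Num.truncn ((x + 1) * N%:R)).

Lemma grid_close N (x y : R) : (0 < N)%N -> `|x| <= 1 -> `|y| <= 1 ->
  grid N x = grid N y -> `|x - y| <= N%:R^-1.
Proof.
rewrite -(ltr0n R) => N0 x1 y1 /(congr1 val).
have bnd (z : R) : `|z| <= 1 -> 0 <= (z + 1) * N%:R /\
    (Num.truncn ((z + 1) * N%:R) < (2 * N).+1)%N.
  rewrite ler_norml => /andP[z0 z1]; split; first by rewrite mulr_ge0 //; lra.
  rewrite ltnS truncn_le_nat -natr1 natrM; nra.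
have [x0 xN] := bnd _ x1; have [y0 yN] := bnd _ y1.
rewrite /= !inordK // => e; have := truncn_itv x0; have := truncn_itv y0.
rewrite e -natr1; move: ((Num.truncn _)%:R : R) => t /andP[h1 h2] /andP[h3 h4].
rewrite -[leRHS]mul1r ler_pdivlMr // -{1}(gtr0_norm N0) -normrM ler_norml.
by apply/andP; split; lra.
Qed.

End Adjoint.

(** * Acceptance probabilities and cells of states *)

Section Automaton.
Context {R : realType} {Sigma : finType} (M : mo1gqfa R Sigma).

Lemma density_qrun w : density (qrun M w).
Proof.
rewrite /qrun; elim: w (qinit M) (qinitP M) => //= s w IH rho rhoP.
exact/IH/density_quantum_operation/rhoP/qopP.
Qed.

Lemma heisenberg_effect w : exists A, entries_le1 A /\
  forall u, accept_prob M (u ++ w) = \tr (A *m qrun M u).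
Proof.
(* All matrices [X] are covered, since the induction strips the first letter of [w], whose operation
   is applied to [X]. *)
suff [A [pA pA' AE]] : exists A, [/\ psdmx A, psdmx (1%:M - A)
    & forall X, \tr (qacc M *m foldl (fun rho s => qop s rho) X w)
                = \tr (A *m X)].
  exists A; split; first exact: effect_entries_le1.
  by move=> u; rewrite /accept_prob /qrun foldl_cat AE.
elim: w => [|s w [A [pA pA' AE]]] /=.
  exists (qacc M); split=> //; first exact/orthogonal_projector_psd/qaccP.
  exact/orthogonal_projector_psd/orthogonal_projectorC/qaccP.
have [B [pB pB' BE]] := dual_effect (qopP M s) pA pA'.
by exists B; split=> // X; rewrite AE BE.
Qed.

Definition state_cell (N : nat) (w : seq Sigma) :
    {ffun 'I_(qdim M) * 'I_(qdim M) -> 'I_(2 * N).+1 * 'I_(2 * N).+1} :=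
  [ffun k => let z := qrun M w k.1 k.2 in
             (grid N (complex.Re z), grid N (complex.Im z))].

Lemma state_cell_accept_prob N u v w : (0 < N)%N ->
  state_cell N u = state_cell N v ->
  complex.Re (accept_prob M (u ++ w)) - complex.Re (accept_prob M (v ++ w))
    <= (qdim M * qdim M)%:R * (N%:R^-1 *+ 2).
Proof.
move=> N0 uv; have [A [A1 AE]] := heisenberg_effect w.
have ReB (x y : R[i]) : complex.Re x - complex.Re y = complex.Re (x - y).
  by case: x y => ? ? [? ?].
rewrite ReB !AE -raddfB -mulmxBr Re_trmul_le // => i j.
have := density_entries_le1 (density_qrun u) i j.
have := density_entries_le1 (density_qrun v) i j.
move/ffunP/(_ (i, j)): uv; rewrite !ffunE !mxE /=.
case: (qrun M u i j) (qrun M v i j) => a b [c d] /= [eac ebd] [c1 d1] [a1 b1].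
by split; apply: (@grid_close _ N).
Qed.

End Automaton.

Theorem theorem5 (R : realType) (Sigma : finType) (L : set (seq Sigma))
    (hL : exists (M : mo1gqfa R Sigma) (eps : R),
        0 < eps /\ recognizes M eps L) :
  regular L.
Proof.
have [M [eps [eps0 [lam [_ accL rejL]]]]] := hL.
pose q : R := (qdim M * qdim M)%:R.
(* N exceeds q / eps, so the variation 2 q / N within a cell stays below the gap 2 eps. *)
pose N := (Num.truncn (q / eps)).+1.
have qN : q * (N%:R^-1 *+ 2) < eps *+ 2.
  rewrite mulrnAr ltrMn2r //= ltr_pdivrMr ?ltr0n //.
  by rewrite mulrC -ltr_pdivrMr // truncnS_gt.
apply: (@regular_of_finite_right_coloring _ _ _ (state_cell M N)) => u v uv w.
move=> Lu; apply: contrapT => nLv.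
(* With [u ++ w] in [L] and [v ++ w] outside, the difference would be at least 2 eps; a one-sided
   bound thus suffices. *)
have := @state_cell_accept_prob _ _ M N u v w isT uv.
move: (accL _ Lu) (rejL _ nLv); rewrite !lecE /= => /andP[_ h1] /andP[_ h2].
rewrite -/q => h3; move: qN; rewrite mulr2n; lra.
Qed.
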